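(* Let $\mu=\nu_s$ be the Gaussian measure on functions on $\mathbb{T}^d$ described in the context, and let $\Phi(t)$, $t\in\mathbb{R}$, be the globally defined solution map of a nonlinear dispersive PDE on $\mathbb{T}^d$ such that $\mu$ is quasi-invariant under $\Phi(t)$. Let $\mu^t=\Phi(t)_*\mu$ be the pushforward of $\mu$ under $\Phi(t)$ and let $\frac{d\mu^t}{d\mu}$ be its Radon-Nikodym derivative. Suppose that $\frac{d\mu^t}{d\mu}\in L^2(d\mu)$ for some $t\in\mathbb{R}$. Then, for this $t$, $$N(n,t)=\int|\widehat{\varphi}(n)|^2\,\frac{d\mu^t}{d\mu}(\varphi)\,d\mu(\varphi)$$ for any $n\in\mathbb{Z}^d$, where $N(n,t)=\mathbb{E}\big[|\widehat{u}_n(t)|^2\big]$ is the two-point function of the solution $u(t)=\Phi(t)\varphi$ with initial data $u(0)=\varphi$ distributed according to $\mu$.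
   Context: $\mathbb{T}^d$ is the $d$-dimensional torus, with characters written $e^{in\cdot x}$, $n\in\mathbb{Z}^d$ (harmless factors of $2\pi$ are dropped); $\widehat{\varphi}(n)=\widehat\varphi_n$ is the $n$-th Fourier coefficient and $\langle n\rangle=(1+|n|^2)^{1/2}$. The measure $\mu=\nu_s$, formally $Z_s^{-1}e^{-\frac12\|u\|_{H^s}^2}du$, is the law of $$\varphi^\omega(x)=\sum_{n\in\mathbb{Z}^d}\frac{\mathfrak{g}_n(\omega)}{\langle n\rangle^{s}}e^{in\cdot x},$$ where $\{\mathfrak{g}_n\}_{n\in\mathbb{Z}^d}$ are independent standard complex-valued Gaussian random variables on a probability space $(\Omega,\mathcal{F},P)$ (in the real-valued setting one imposes $\mathfrak{g}_{-n}=\overline{\mathfrak{g}_n}$). One considers a nonlinear dispersive PDE on $\mathbb{T}^d$ for a scalar function $u$ with random initial data $u(0)=\varphi$ distributed according to $\mu$; solutions are assumed to exist globally in time, so that the (measurable) solution map $\Phi(t):u(0)=\varphi\mapsto u(t)$ is well defined for all $t\in\mathbb{R}$ on the function space supporting $\mu$. Quasi-invariance of $\mu$ under $\Phi(t)$ means that, for every $t$, $\Phi(t)_*\mu=\mu\circ\Phi(t)^{-1}$ and $\mu$ are mutually absolutely continuous. *)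

(* Defs.v *)
From HB Require Import structures.
From mathcomp Require Import all_boot all_order all_algebra.
From mathcomp Require Import all_classical all_reals all_analysis.
From mathcomp Require Import measurable_realfun complex.
Set Implicit Arguments.
Unset Strict Implicit.
Unset Printing Implicit Defensive.
Import Order.TTheory GRing.Theory Num.Theory.
Import numFieldNormedType.Exports.
Local Open Scope classical_set_scope.
Local Open Scope charge_scope.
Local Open Scope ring_scope.

Notation Zd d := 'rV[int]_d (only parsing).

Definition japanese (R : realType) (d : nat) (n : Zd d) : R :=
  Num.sqrt (1 + \sum_(j < d) (n 0 j)%:~R ^+ 2).

(* A (generalised) function on the torus T^d is given by its Fourier series
   sum_n f n * e^{i n.x}; polynomial growth of the coefficients characterises
   the series which converge in the space D'(T^d) of periodic distributions. *)
Definition polynomial_growth (R : realType) (d : nat) (f : Zd d -> R[i]) :=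
  exists (C : R) (k : nat), forall n, Normc.normc (f n) <= C * japanese R n ^+ k.

(* A function space on T^d on which the equation is posed, for instance a
   Sobolev space H^sigma(T^d), or a subset of full measure of such a space. *)
Record function_space (R : realType) (d : nat) := FunctionSpace {
  fs_carrier : set (Zd d -> R[i]) ;
  fs_nonempty : exists f, fs_carrier f ;
  fs_distribution : forall f, fs_carrier f -> polynomial_growth f }.

Definition fs_elt (R : realType) (d : nat) (X : function_space R d) : Type :=
  {f : Zd d -> R[i] | fs_carrier X f}.

Definition fs_point (R : realType) (d : nat) (X : function_space R d) :
  fs_elt X := let: exist f Xf := cid (fs_nonempty X) in exist _ f Xf.

HB.instance Definition _ (R : realType) (d : nat) (X : function_space R d) :=
  gen_eqMixin (fs_elt X).
HB.instance Definition _ (R : realType) (d : nat) (X : function_space R d) :=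
  gen_choiceMixin (fs_elt X).
HB.instance Definition _ (R : realType) (d : nat) (X : function_space R d) :=
  isPointed.Build (fs_elt X) (fs_point X).

Definition fourier (R : realType) (d : nat) (X : function_space R d)
  (f : fs_elt X) (n : Zd d) : R[i] := proj1_sig f n.

Definition real_pair (R : realType) (z : R[i]) : R * R :=
  (complex.Re z, complex.Im z).

(* The sigma-algebra generated by the Fourier coefficients; on a separable
   Sobolev space it is the Borel sigma-algebra. *)
Definition cylinder (R : realType) (d : nat) (X : function_space R d) :
    set (set (fs_elt X)) :=
  [set A | exists (n : Zd d) (B : set (R * R)),
    measurable B /\ A = [set f | B (real_pair (fourier f n))]].

Definition state (R : realType) (d : nat) (X : function_space R d) :=
  g_sigma_algebraType (cylinder (X := X)).

(* The law of (Re g, Im g): two independent N(0, 1/2) variables, so that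
   E|g|^2 = 1. *)
Definition standard_complex_gaussian (R : realType) (dO : measure_display)
    (Omega : measurableType dO) (P : probability Omega R)
    (g : Omega -> R[i]) :=
  let sigma : R := Num.sqrt 2^-1 in
  measurable_fun [set: Omega] (@real_pair R \o g) /\
  forall A : set (R * R), measurable A ->
    P ((@real_pair R \o g) @^-1` A) =
    (normal_prob 0 sigma \x normal_prob 0 sigma)%E A.

Definition standard_real_gaussian (R : realType) (dO : measure_display)
    (Omega : measurableType dO) (P : probability Omega R)
    (g : Omega -> R[i]) :=
  [/\ measurable_fun [set: Omega] (@real_pair R \o g),
      forall w, complex.Im (g w) = 0 &
      forall A : set R, measurable A ->
        P ((fun w => complex.Re (g w)) @^-1` A) = normal_prob 0 1 A].

Definition finitely_independent (R : realType) (dO : measure_display)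
    (Omega : measurableType dO) (P : probability Omega R) (I : eqType)
    (g : I -> Omega -> R[i]) (J : seq I) :=
  forall B : I -> set (R * R), (forall j, measurable (B j)) ->
    P (\bigcap_(j in [set` J]) ((@real_pair R \o g j) @^-1` B j)) =
    (\prod_(j <- J) fine (P ((@real_pair R \o g j) @^-1` B j)))%:E.

Inductive setting := ComplexValued | RealValued.

(* In the real-valued setting g_{-n} is the conjugate of g_n, g_0 is a standard
   real Gaussian, and independence holds for every finite family of indices
   which contains at most one element of each pair {n, -n}. *)
Definition gaussian_family (R : realType) (d : nat) (dO : measure_display)
    (Omega : measurableType dO) (P : probability Omega R) (k : setting)
    (g : Zd d -> Omega -> R[i]) :=
  match k with
  | ComplexValued =>
      (forall n, standard_complex_gaussian P (g n)) /\
      (forall J : seq (Zd d), uniq J -> finitely_independent P g J)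
  | RealValued =>
      [/\ forall n w, g (- n) w = conjc (g n w),
          forall n, n != 0 -> standard_complex_gaussian P (g n),
          standard_real_gaussian P (g 0) &
          forall J : seq (Zd d), uniq J ->
            (forall n m, n \in J -> m \in J -> n != m -> n != - m) ->
            finitely_independent P g J]
  end.

(* phi = sum_n g_n / <n>^s e^{i n.x}, almost surely; nu_s is the law of phi. *)
Definition random_fourier_series (R : realType) (d : nat)
    (X : function_space R d) (dO : measure_display)
    (Omega : measurableType dO) (P : probability Omega R) (s : R)
    (g : Zd d -> Omega -> R[i]) (phi : Omega -> state X) :=
  {ae P, forall w, forall n : Zd d,
    fourier (phi w) n = ((japanese R n `^ s)^-1)%:C%C * g n w}.

(* The equation i u_t = omega(D) u + N(t, u) with a real dispersion relation
   omega; in Fourier variables i (u_n)' = omega(n) u_n + N(t, u)_n. The map N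
   need not be polynomial, nor continuous, and may be nonlocal in x. *)
Record dispersive_pde (R : realType) (d : nat) (X : function_space R d) :=
  DispersivePDE {
    dispersion : Zd d -> R ;
    nonlinearity : R -> state X -> Zd d -> R[i] ;
    dispersion_growth :
      polynomial_growth (fun n => (dispersion n)%:C%C) ;
    nonlinearity_distribution :
      forall t f, polynomial_growth (nonlinearity t f) }.

Definition pde_rhs (R : realType) (d : nat) (X : function_space R d)
    (E : dispersive_pde X) (u : R -> state X) (n : Zd d) (t : R) : R[i] :=
  (dispersion E n)%:C%C * fourier (u t) n + nonlinearity E t (u t) n.

(* Time-integrated form of the equation, tested against each character. *)
Definition global_solution (R : realType) (d : nat) (X : function_space R d)
    (E : dispersive_pde X) (u : R -> state X) :=
  forall (n : Zd d) (t1 t2 : R), t1 <= t2 ->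
    let re t := complex.Re (pde_rhs E u n t) in
    let im t := complex.Im (pde_rhs E u n t) in
    [/\ lebesgue_measure.-integrable `[t1, t2] (EFin \o re),
        lebesgue_measure.-integrable `[t1, t2] (EFin \o im) &
        'i%C * (fourier (u t2) n - fourier (u t1) n) =
          (Rintegral lebesgue_measure `[t1, t2] re +i*
           Rintegral lebesgue_measure `[t1, t2] im)%C].

Definition solution_map (R : realType) (d : nat) (X : function_space R d)
    (E : dispersive_pde X) (Phi : R -> {mfun state X >-> state X}) :=
  forall f : state X, Phi 0 f = f /\ global_solution E (fun t => Phi t f).

(* [distribution mu (Phi t)] is the pushforward of mu under Phi t. *)
Definition quasi_invariant (R : realType) (d : measure_display)
    (T : measurableType d) (mu : probability T R)
    (Phi : R -> {mfun T >-> T}) :=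
  forall t, distribution mu (Phi t) `<< mu /\ mu `<< distribution mu (Phi t).

Definition density (R : realType) (d : measure_display)
    (T : measurableType d) (mu : probability T R)
    (Phi : R -> {mfun T >-> T}) (t : R) : T -> \bar R :=
  'd (charge_of_finite_measure (distribution mu (Phi t))) '/d mu.

Definition square_integrable (R : realType) (d : measure_display)
    (T : measurableType d) (mu : probability T R) (h : T -> \bar R) :=
  measurable_fun [set: T] h /\ (Lnorm mu 2%:E h < +oo)%E.

Definition two_point (R : realType) (d : nat) (X : function_space R d)
    (dO : measure_display) (Omega : measurableType dO)
    (P : probability Omega R) (phi : Omega -> state X)
    (Phi : R -> {mfun state X >-> state X}) (n : Zd d) (t : R) : \bar R :=
  expectation P (fun w => Normc.normc (fourier (Phi t (phi w)) n) ^+ 2).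

(* Main.v *)
Require Import Defs.
From HB Require Import structures.
From mathcomp Require Import all_boot all_order all_algebra.
From mathcomp Require Import all_classical all_reals all_analysis.
From mathcomp Require Import measurable_realfun complex.
From mathcomp Require Import ring lra.
Import Order.TTheory GRing.Theory Num.Theory.
Import numFieldNormedType.Exports.
Local Open Scope classical_set_scope.
Local Open Scope ring_scope.

(** The two-point function is [E |u_n(t)|^2], that is, the integral of
    [|f_n|^2] against the pushforward [mu^t], and the change of variables
    formula for the Radon-Nikodym derivative turns it into the integral of
    [|f_n|^2 (dmu^t/dmu)] against [mu]. The product is integrable because
    [f_n] is a multiple of a Gaussian, so that [|f_n|^2] is in [L^2(mu)], as is
    [dmu^t/dmu]. *)

(** * Change of variables for Radon-Nikodym derivatives *)

(** The derivative of [nu] seen as a charge agrees [mu]-almost everywhere with its derivative as a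
    measure, for which the formula holds for nonnegative functions. Both sides may be infinite. *)
Lemma ge0_Radon_Nikodym_change_of_variables (R : realType)
    (d : measure_display) (T : measurableType d)
    (nu : {finite_measure set T -> \bar R})
    (mu : {sigma_finite_measure set T -> \bar R}) (f : T -> \bar R) :
  nu `<< mu -> measurable_fun [set: T] f -> (forall x, (0 <= f x)%E) ->
  (\int[mu]_x (f x * Radon_Nikodym (charge_of_finite_measure nu) mu x) =
   \int[nu]_x f x)%E.
Proof.
move=> numu mf f0.
rewrite -(Radon_Nikodym_SigmaFinite.change_of_variables numu)//.
apply: ae_eq_integral => //.
- exact: emeasurable_funM.
- apply: emeasurable_funM => //.
  exact: (measurable_int _ (Radon_Nikodym_SigmaFinite.f_integrable numu)).
- exact/ae_eqe_mul2l/ae_eq_sym/ae_eq_Radon_Nikodym_SigmaFinite.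
Qed.

(** * Fourth moments of real Gaussian laws *)

Lemma ge0_integral_normal_prob (R : realType) (m s : R) (f : R -> \bar R) :
  measurable_fun [set: R] f -> (forall x, (0 <= f x)%E) ->
  (\int[normal_prob m s]_x f x =
   \int[lebesgue_measure]_x (f x * (normal_pdf m s x)%:E))%E.
Proof.
move=> mf f0; have nl := normal_prob_dominates m s.
rewrite -(ge0_Radon_Nikodym_change_of_variables _ _ _ _ _ _ nl)//.
have mpdf : measurable_fun [set: R] (EFin \o normal_pdf m s).
  by apply/measurable_EFinP; exact: measurable_normal_pdf.
apply: ae_eq_integral => //.
- exact: emeasurable_funM.
- exact: emeasurable_funM.
(* The abstract derivative and the explicit density have the same integral over every measurable
   set, so they agree almost everywhere. *)
apply: ae_eqe_mul2l; apply: integral_ae_eq => //.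
- exact: Radon_Nikodym_integrable.
- by move=> A _ mA; rewrite -Radon_Nikodym_integral.
Qed.

(* [normal_pdf 0 s x = c * normal_pdf 0 (2 * s) x * exp (- y)] with
   [y = 3 x^2 / (8 s^2)], and [y^2 <= 2 exp y]; the constant on the right is
   [128/9 = 2 * (8/3)^2]. *)
Lemma normal_pdf_fourth_moment_le (R : realType) (s x : R) : s != 0 ->
  x ^+ 4 * normal_pdf 0 s x <=
  128%:R / 9%:R * s ^+ 4 * normal_peak s / normal_peak (2 * s) *
    normal_pdf 0 (2 * s) x.
Proof.
move=> s0; have s20 : 2 * s != 0 by rewrite mulf_neq0// pnatr_eq0.
rewrite !normal_pdfE//= /normal_fun !subr0.
have p2 : normal_peak (2 * s) != 0 by rewrite gt_eqF// normal_peak_gt0.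
have p1 := normal_peak_ge0 s.
set y := 3%:R / 8%:R * (x ^+ 2 / s ^+ 2).
have y0 : 0 <= y by rewrite mulr_ge0// divr_ge0// sqr_ge0.
have := expR_ge1Dxn 1%N y0; rewrite (_ : 2`!%:R = 2%:R)// => yle.
(* The coefficient 3/8 in [y] is 1/2 - 1/8, the gap between the two Gaussian exponents. *)
have -> : - x ^+ 2 / ((2 * s) ^+ 2 *+ 2) = - x ^+ 2 / (s ^+ 2 *+ 2) + y.
  by rewrite /y; field.
rewrite expRD; set e := expR (- _ / _); set p := normal_peak s in p1 *.
have e0 : 0 <= e by exact: expR_ge0.
rewrite [leRHS](_ : _ =
   p * e * (128%:R / 9%:R * s ^+ 4 * expR y)); last by field.
rewrite [leLHS]mulrC; apply: ler_wpM2l; first exact: mulr_ge0.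
have -> : x ^+ 4 = 64%:R / 9%:R * s ^+ 4 * y ^+ 2 by rewrite /y; field.
have s4 : 0 <= s ^+ 4 by rewrite exprn_even_ge0.
have -> : 128%:R / 9%:R * s ^+ 4 * expR y =
    64%:R / 9%:R * s ^+ 4 * (2 * expR y) by field.
apply: ler_wpM2l; first by rewrite mulr_ge0.
lra.
Qed.

(** The integrand is dominated by a multiple of the density with doubled deviation, whose integral
    is 1; the moment itself is never computed. *)
Lemma normal_prob_fourth_moment_lty (R : realType) (s : R) : s != 0 ->
  (\int[normal_prob 0 s]_x (x ^+ 4)%:E < +oo)%E.
Proof.
move=> s0; rewrite ge0_integral_normal_prob; first last.
- by move=> x; rewrite lee_fin exprn_even_ge0.
- by apply/measurable_EFinP; exact: measurable_funX.
set c := 128%:R / 9%:R * s ^+ 4 * normal_peak s / normal_peak (2 * s).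
have c0 : 0 <= c.
  have ? : 0 <= s ^+ 4 by exact: exprn_even_ge0.
  by rewrite divr_ge0 ?normal_peak_ge0// mulr_ge0 ?normal_peak_ge0// mulr_ge0.
apply: (@le_lt_trans _ _
  (\int[lebesgue_measure]_x (c%:E * (normal_pdf 0 (2 * s) x)%:E))%E).
  apply: ge0_le_integral => //.
  - move=> x _; rewrite mule_ge0// lee_fin ?normal_pdf_ge0//.
    by rewrite exprn_even_ge0.
  - apply/measurable_EFinP; apply: measurable_funM.
      exact: measurable_funX.
    exact: measurable_normal_pdf.
  - apply/measurable_EFinP; apply: measurable_funM => //.
    exact: measurable_normal_pdf.
  - by move=> x _; rewrite -!EFinM lee_fin; exact: normal_pdf_fourth_moment_le.
rewrite ge0_integralZl//.
- by rewrite integral_normal_pdf mule1 ltry.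
- by apply/measurable_EFinP; exact: measurable_normal_pdf.
- by move=> x _; rewrite lee_fin normal_pdf_ge0.
Qed.

Lemma normal_fourth_moment_lty (R : realType) (d : measure_display)
    (T : measurableType d) (P : probability T R) (Y : T -> R) (s : R) :
  s != 0 -> measurable_fun [set: T] Y ->
  (forall A, measurable A -> P (Y @^-1` A) = normal_prob 0 s A) ->
  (\int[P]_w (Y w ^+ 4)%:E < +oo)%E.
Proof.
move=> s0 mY PY.
(* [normal_prob] is a measure on [measurableTypeR R], whose display is not the
   default one of [R]; the sigma-algebras are convertible. *)
have mY' : measurable_fun [set: T] (Y : T -> measurableTypeR R) := mY.
pose X : {mfun T >-> measurableTypeR R} :=
  HB.pack (Y : T -> measurableTypeR R) (isMeasurableFun.Build _ _ _ _ _ mY').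
suff -> : (\int[P]_w (Y w ^+ 4)%:E = \int[normal_prob 0 s]_x (x ^+ 4)%:E)%E.
  exact: normal_prob_fourth_moment_lty.
transitivity (\int[distribution P X]_x (x ^+ 4)%:E)%E.
  rewrite ge0_integral_distribution//.
    by apply/measurable_EFinP; exact: measurable_funX.
  by move=> x; rewrite lee_fin exprn_even_ge0.
by apply: eq_measure_integral => A mA _; exact: PY.
Qed.

(** * Fourth moments of complex Gaussian coefficients *)

Lemma normc_sqr (R : realType) (z : R[i]) :
  Normc.normc z ^+ 2 = (real_pair z).1 ^+ 2 + (real_pair z).2 ^+ 2.
Proof. by case: z => x y /=; rewrite sqr_sqrtr// addr_ge0// sqr_ge0. Qed.

(** The real and imaginary parts are separated by (a^2 + b^2)^2 <= 2 (a^4 + b^4), where the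
    difference of the two sides is (a^2 - b^2)^2. *)
Lemma normc_fourth_moment_lty (R : realType) (d : measure_display)
    (T : measurableType d) (P : probability T R) (g : T -> R[i]) :
  measurable_fun [set: T] (@real_pair R \o g) ->
  (\int[P]_w ((real_pair (g w)).1 ^+ 4)%:E < +oo)%E ->
  (\int[P]_w ((real_pair (g w)).2 ^+ 4)%:E < +oo)%E ->
  (\int[P]_w (Normc.normc (g w) ^+ 4)%:E < +oo)%E.
Proof.
move=> mg gx gy.
have mx : measurable_fun [set: T] (fun w => (real_pair (g w)).1).
  exact: measurableT_comp measurable_fst mg.
have my : measurable_fun [set: T] (fun w => (real_pair (g w)).2).
  exact: measurableT_comp measurable_snd mg.
have p4 (r : R) : 0 <= r ^+ 4 by rewrite exprn_even_ge0.
have normE w : Normc.normc (g w) ^+ 4 =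
    ((real_pair (g w)).1 ^+ 2 + (real_pair (g w)).2 ^+ 2) ^+ 2.
  by rewrite -[4%N]/(2 * 2)%N exprM normc_sqr.
apply: (@le_lt_trans _ _ (\int[P]_w (2%:E * (((real_pair (g w)).1 ^+ 4)%:E +
    ((real_pair (g w)).2 ^+ 4)%:E)))%E).
  apply: ge0_le_integral => //.
  - by move=> w _; rewrite lee_fin.
  - apply/measurable_EFinP; under eq_fun do rewrite normE.
    by apply: measurable_funX; apply: measurable_funD; exact: measurable_funX.
  - apply/measurable_EFinP; apply: measurable_funM => //.
    by apply: measurable_funD; exact: measurable_funX.
  - move=> w _; rewrite -EFinD -EFinM lee_fin normE.
    set a := _.1; set b := _.2; rewrite -subr_ge0.
    rewrite (_ : _ - _ = (a ^+ 2 - b ^+ 2) ^+ 2) ?sqr_ge0//; ring.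
rewrite ge0_integralZl//; last 2 first.
- by apply/measurable_EFinP; apply: measurable_funD; exact: measurable_funX.
- by move=> w _; rewrite adde_ge0// lee_fin.
rewrite ge0_integralD//; first last.
- by apply/measurable_EFinP; exact: measurable_funX.
- by move=> w _; rewrite lee_fin.
- by apply/measurable_EFinP; exact: measurable_funX.
- by move=> w _; rewrite lee_fin.
by rewrite lte_mul_pinfty// lte_add_pinfty.
Qed.

(** Each marginal is read off by testing the product law on a strip, the other factor having total
    mass 1. *)
Lemma standard_complex_gaussian_fourth_moment_lty (R : realType)
    (d : measure_display) (T : measurableType d) (P : probability T R)
    (g : T -> R[i]) :
  standard_complex_gaussian P g ->
  (\int[P]_w (Normc.normc (g w) ^+ 4)%:E < +oo)%E.
Proof.
move=> [mg Pg].
have s0 : Num.sqrt (2^-1 : R) != 0 by rewrite gt_eqF// sqrtr_gt0.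
have nT : normal_prob 0 (Num.sqrt (2^-1 : R)) setT = 1%E.
  exact: integral_normal_pdf.
apply: normc_fourth_moment_lty => //.
- apply: (normal_fourth_moment_lty _ _ _ _ _ _ s0).
    exact: measurableT_comp measurable_fst mg.
  move=> A mA; have := Pg (A `*` setT) (measurableX mA measurableT).
  rewrite product_measure1E// [X in (_ * X)%E]nT mule1 => <-.
  by congr (P _); apply/seteqP; split => w //= -[].
- apply: (normal_fourth_moment_lty _ _ _ _ _ _ s0).
    exact: measurableT_comp measurable_snd mg.
  move=> A mA; have := Pg (setT `*` A) (measurableX measurableT mA).
  rewrite product_measure1E// [X in (X * _)%E]nT mul1e => <-.
  by congr (P _); apply/seteqP; split => w //= -[].
Qed.

Lemma standard_real_gaussian_fourth_moment_lty (R : realType)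
    (d : measure_display) (T : measurableType d) (P : probability T R)
    (g : T -> R[i]) :
  standard_real_gaussian P g ->
  (\int[P]_w (Normc.normc (g w) ^+ 4)%:E < +oo)%E.
Proof.
move=> [mg Img Pg]; apply: normc_fourth_moment_lty => //.
- apply: (normal_fourth_moment_lty _ _ _ _ _ _ (oner_neq0 R)).
    exact: measurableT_comp measurable_fst mg.
  exact: Pg.
- under eq_integral do rewrite /= Img expr0n/=.
  by rewrite integral0 ltry.
Qed.

Lemma gaussian_family_fourth_moment_lty (R : realType) (d : nat)
    (dO : measure_display) (Omega : measurableType dO)
    (P : probability Omega R) (k : setting) (g : 'rV[int]_d -> Omega -> R[i])
    (n : 'rV[int]_d) :
  gaussian_family P k g ->
  measurable_fun [set: Omega] (@real_pair R \o g n) /\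
  (\int[P]_w (Normc.normc (g n w) ^+ 4)%:E < +oo)%E.
Proof.
case: k => [[gC _]|[_ gC gR _]].
  split; first by case: (gC n).
  exact: standard_complex_gaussian_fourth_moment_lty.
(* In the real-valued setting the index 0 is its own opposite, so [g 0] is a real Gaussian and is
   treated apart. *)
have [->|n0] := eqVneq n 0.
  split; first by case: gR.
  exact: standard_real_gaussian_fourth_moment_lty.
split; first by case: (gC n n0).
exact: standard_complex_gaussian_fourth_moment_lty (gC n n0).
Qed.

(** * Measurability and moments of the Fourier coefficients *)

Lemma measurable_normcX (R : realType) (d : measure_display)
    (T : measurableType d) (g : T -> R[i]) (m : nat) :
  measurable_fun [set: T] (@real_pair R \o g) ->
  measurable_fun [set: T] (fun w => Normc.normc (g w) ^+ m).
Proof.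
move=> mg; apply: measurable_funX.
have -> : (fun w => Normc.normc (g w)) = (fun w =>
    Num.sqrt ((real_pair (g w)).1 ^+ 2 + (real_pair (g w)).2 ^+ 2)).
  by apply/funext => w; case: (g w).
apply: measurableT_comp.
  by apply: continuous_measurable_fun; exact: sqrt_continuous.
apply: measurable_funD; apply: measurable_funX.
- exact: measurableT_comp measurable_fst mg.
- exact: measurableT_comp measurable_snd mg.
Qed.

(** The preimages in question are generators of the sigma-algebra of [state X]. *)
Lemma measurable_real_pair_fourier (R : realType) (d : nat)
    (X : function_space R d) (n : 'rV[int]_d) :
  measurable_fun [set: state X] (fun f : state X => real_pair (fourier f n)).
Proof.
move=> _ B mB; rewrite setTI; apply: sub_sigma_algebra.
by exists n, B.
Qed.

Lemma random_fourier_series_fourth_moment_lty (R : realType) (d : nat)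
    (s : R) (k : setting) (X : function_space R d) (dO : measure_display)
    (Omega : measurableType dO) (P : probability Omega R)
    (g : 'rV[int]_d -> Omega -> R[i]) (phi : {mfun Omega >-> state X})
    (n : 'rV[int]_d) :
  gaussian_family P k g -> random_fourier_series P s g phi ->
  (\int[distribution P phi]_f (Normc.normc (fourier f n) ^+ 4)%:E < +oo)%E.
Proof.
move=> /(gaussian_family_fourth_moment_lty _ _ _ _ _ _ _ n)[mg g4] phiE.
have mf := measurable_real_pair_fourier R d X n.
rewrite ge0_integral_distribution//; last 2 first.
- by apply/measurable_EFinP; exact: measurable_normcX.
- by move=> f; rewrite lee_fin exprn_even_ge0.
set c : R := (japanese R n `^ s)^-1.
have c4 : 0 <= c ^+ 4 by rewrite exprn_even_ge0.
apply: (@le_lt_trans _ _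
  (\int[P]_w ((c ^+ 4)%:E * (Normc.normc (g n w) ^+ 4)%:E))%E); last first.
  rewrite ge0_integralZl//.
  - by rewrite lte_mul_pinfty.
  - by apply/measurable_EFinP; exact: measurable_normcX.
  - by move=> w _; rewrite lee_fin exprn_even_ge0.
(* The series representation of [phi] holds only almost surely, hence a comparison almost
   everywhere. *)
apply: ae_ge0_le_integral => //.
- by move=> w _; rewrite lee_fin exprn_even_ge0.
- apply/measurable_EFinP; apply: measurable_normcX.
  exact: measurableT_comp mf _.
- by move=> w _; rewrite -EFinM lee_fin mulr_ge0// exprn_even_ge0.
- apply/measurable_EFinP; apply: measurable_funM => //.
  exact: measurable_normcX.
apply: filterS phiE => w phiw _ /=.
have cN : Normc.normc c%:C%C ^+ 4 = c ^+ 4.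
  by rewrite /= expr0n/= addr0 sqrtr_sqr -normrX ger0_norm.
by rewrite phiw Normc.normcM exprMn cN -EFinM.
Qed.

(** * Integrability of the product and conclusion *)

(** The product is dominated pointwise through |ab| <= a^2 + b^2, and both squares are integrable.
    Finiteness of [h] allows passing to [fine]. *)
Lemma integrable_mul_Lnorm2 (R : realType) (d : measure_display)
    (T : measurableType d) (mu : {measure set T -> \bar R})
    (F : T -> R) (h : T -> \bar R) :
  measurable_fun [set: T] F -> measurable_fun [set: T] h ->
  (forall x, h x \is a fin_num) ->
  (\int[mu]_x (F x ^+ 2)%:E < +oo)%E -> (Lnorm mu 2%:E h < +oo)%E ->
  mu.-integrable [set: T] (fun x => (F x)%:E * h x)%E.
Proof.
move=> mF mh hfin F2 h2.
have {}h2 : (\int[mu]_x (fine (h x) ^+ 2)%:E < +oo)%E.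
  have /(poweR_lty 2) := h2; rewrite poweR_Lnorm ?pnatr_eq0//.
  congr (_ < _)%E; apply: eq_integral => x _.
  rewrite -[in LHS](fineK (hfin x)) abse_EFin poweR_EFin powR_mulrn//.
  by rewrite real_normK// num_real.
have mfh : measurable_fun [set: T] (fine \o h) by exact: measurableT_comp.
apply: (@le_integrable _ _ _ _ _ measurableT _
  (fun x => (F x ^+ 2)%:E + (fine (h x) ^+ 2)%:E)%E).
- by apply: emeasurable_funM => //; exact/measurable_EFinP.
- move=> x _; rewrite -{1}[h x]fineK// -EFinM -EFinD lee_fin.
  set a := F x; set b := fine _.
  rewrite [leRHS]ger0_norm ?addr_ge0 ?sqr_ge0//.
  (* Expanding (a + b)^2 and (a - b)^2 bounds ab from below and from above. *)
  have [a2 b2] : 0 <= a ^+ 2 /\ 0 <= b ^+ 2 by rewrite !sqr_ge0.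
  have [ab ba] : 0 <= (a + b) ^+ 2 /\ 0 <= (a - b) ^+ 2 by rewrite !sqr_ge0.
  by rewrite ler_norml; apply/andP; split; nra.
apply: integrableD => //; apply/integrableP; split.
- by apply/measurable_EFinP; exact: measurable_funX.
- by under eq_integral do rewrite gee0_abs ?lee_fin ?sqr_ge0//.
- by apply/measurable_EFinP; exact: measurable_funX.
- by under eq_integral do rewrite gee0_abs ?lee_fin ?sqr_ge0//.
Qed.

Theorem corollary1p4 (R : realType) (d : nat) (s : R) (k : setting)
  (X : function_space R d)
  (dO : measure_display) (Omega : measurableType dO) (P : probability Omega R)
  (g : 'rV[int]_d -> Omega -> R[i]) (phi : {mfun Omega >-> state X})
  (E : dispersive_pde X) (Phi : R -> {mfun state X >-> state X}) :
  gaussian_family P k g ->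
  random_fourier_series P s g phi ->
  solution_map E Phi ->
  let mu := distribution P phi in
  quasi_invariant mu Phi ->
  forall t : R,
  square_integrable mu (density mu Phi t) ->
  forall n : 'rV[int]_d,
  let integrand (f : state X) : \bar R :=
    ((Normc.normc (fourier f n) ^+ 2)%:E * density mu Phi t f)%E in
  mu.-integrable [set: state X] integrand /\
  two_point P phi Phi n t = (\int[mu]_f integrand f)%E.
Proof.
move=> gP phiE _ mu qi t [mh h2] n integrand.
have [numu _] := qi t.
have mF : measurable_fun [set: state X]
    (fun f : state X => Normc.normc (fourier f n) ^+ 2).
  by apply: measurable_normcX; exact: measurable_real_pair_fourier.
split.
  apply: integrable_mul_Lnorm2 => //.
    by move=> f; exact: Radon_Nikodym_fin_num.
  (* The square of |f_n|^2 is |f_n|^4, so the fourth moment is what is required. *)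
  under eq_integral do rewrite -exprM.
  exact: random_fourier_series_fourth_moment_lty gP phiE.
have mF' : measurable_fun [set: state X]
    (fun f : state X => (Normc.normc (fourier f n) ^+ 2)%:E).
  exact/measurable_EFinP.
have F0 (f : state X) : (0 <= (Normc.normc (fourier f n) ^+ 2)%:E)%E.
  by rewrite lee_fin sqr_ge0.
rewrite /integrand /density ge0_Radon_Nikodym_change_of_variables//.
(* The measure is a pushforward under [phi] and then under [Phi t]; undoing both brings the integral
   back to [Omega]. *)
rewrite ge0_integral_distribution// ge0_integral_distribution//.
- by rewrite /two_point unlock.
- exact: measurableT_comp mF' _.
- by move=> f; exact: F0.
Qed.
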